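(* Consider a port-Hamiltonian descriptor system $$E\dot x=(J-R)x+(G-P)u,\qquad y=(G+P)^Tx+(S+N)u,$$ with real coefficient matrices $E,J,R\in\mathbb{R}^{n\times n}$, $G,P\in\mathbb{R}^{n\times m}$, $S,N\in\mathbb{R}^{m\times m}$ (so that the structural conditions in the definition of a port-Hamiltonian descriptor system hold). For $F\in\mathbb{R}^{m\times n}$ let $$\tilde J=J+\tfrac12[(G-P)F-F^T(G-P)^T],\qquad \tilde R=R-\tfrac12[(G-P)F+F^T(G-P)^T],$$ $$\tilde G=G+\tfrac12F^T(S+N)^T,\qquad \tilde P=P+\tfrac12F^T(S+N)^T,$$ so that the state feedback $u=Fx+v$ yields the closed-loop system $$E\dot x=(\tilde J-\tilde R)x+(\tilde G-\tilde P)v,\qquad y=(\tilde G+\tilde P)^Tx+(S+N)v.$$ There exists a matrix $F\in\mathbb{R}^{m\times n}$ such that the closed-loop system is strictly passive, i.e. such that $$\begin{bmatrix}\tilde R&\tilde P\\ \tilde P^T&S\end{bmatrix}>0,$$ if and only if $S>0$ and $$R+\tfrac12(G-P)(S+N)^{-1}(G+P)^T+\tfrac12(G+P)(S+N)^{-T}(G-P)^T>0.$$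
   Context: A linear time-invariant descriptor system $E\dot x=(J-R)x+(G-P)u$, $y=(G+P)^Tx+(S+N)u$ with $E,J,R\in\mathbb{R}^{n\times n}$, $G,P\in\mathbb{R}^{n\times m}$, $S,N\in\mathbb{R}^{m\times m}$, $S=S^T$, $N=-N^T$, is called port-Hamiltonian if $$E=E^T\ge 0,\qquad \begin{bmatrix} J & G\\ -G^T & N\end{bmatrix}=-\begin{bmatrix} J & G\\ -G^T & N\end{bmatrix}^T,\qquad \begin{bmatrix} R & P\\ P^T & S\end{bmatrix}=\begin{bmatrix} R & P\\ P^T & S\end{bmatrix}^T\ge 0.$$ Here $M\ge 0$ ($M>0$) means that the symmetric matrix $M$ is positive semi-definite (positive definite), and $M^{-T}=(M^{-1})^T$. (If $S>0$ and $N=-N^T$, then $S+N$ is invertible, so the second condition makes sense whenever the first one holds.) The closed-loop system is called strictly passive if its dissipation matrix $\begin{bmatrix}\tilde R&\tilde P\\ \tilde P^T&S\end{bmatrix}$ is positive definite. *)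

(* Defs.v *)
From mathcomp Require Import all_boot all_order all_algebra.
From mathcomp Require Import reals ring.

Set Implicit Arguments.
Unset Strict Implicit.
Unset Printing Implicit Defensive.

Import Order.TTheory GRing.Theory Num.Theory.
Local Open Scope ring_scope.

(* Symmetry is part of both predicates: M >= 0 and M > 0 are only used for
   symmetric M. *)
Definition psdmx (K : realType) (n : nat) (M : 'M[K]_n) : Prop :=
  M = M^T /\ forall x : 'cV[K]_n, 0 <= (x^T *m M *m x) 0 0.

Definition pdmx (K : realType) (n : nat) (M : 'M[K]_n) : Prop :=
  M = M^T /\ forall x : 'cV[K]_n, x != 0 -> 0 < (x^T *m M *m x) 0 0.

(* Coefficients of
     E x' = (J - R) x + (G - P) u,   y = (G + P)^T x + (S + N) u,
   without any structural condition; these are in [port_hamiltonian]. *)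
Record descriptor (K : realType) (n m : nat) : Type := Descriptor {
  matE : 'M[K]_n;
  matJ : 'M[K]_n;
  matR : 'M[K]_n;
  matG : 'M[K]_(n, m);
  matP : 'M[K]_(n, m);
  matS : 'M[K]_m;
  matN : 'M[K]_m
}.

(* The pointwise system equations, dx being the value of x'. *)
Definition system_eqs (K : realType) (n m : nat) (sys : descriptor K n m)
    (dx x : 'cV[K]_n) (u y : 'cV[K]_m) : Prop :=
  matE sys *m dx = (matJ sys - matR sys) *m x + (matG sys - matP sys) *m u /\
  y = (matG sys + matP sys)^T *m x + (matS sys + matN sys) *m u.

Definition structure_mx (K : realType) (n m : nat) (sys : descriptor K n m) :
    'M[K]_(n + m) :=
  block_mx (matJ sys) (matG sys) (- (matG sys)^T) (matN sys).

Definition dissipation_mx (K : realType) (n m : nat) (sys : descriptor K n m) :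
    'M[K]_(n + m) :=
  block_mx (matR sys) (matP sys) (matP sys)^T (matS sys).

Record port_hamiltonian (K : realType) (n m : nat) (sys : descriptor K n m) :
    Prop := PortHamiltonian {
  ph_symS : matS sys = (matS sys)^T;
  ph_skewN : matN sys = - (matN sys)^T;
  ph_psdE : psdmx (matE sys);
  ph_structure : structure_mx sys = - (structure_mx sys)^T;
  ph_dissipation : psdmx (dissipation_mx sys)
}.

Definition strictly_passive (K : realType) (n m : nat)
    (sys : descriptor K n m) : Prop :=
  pdmx (dissipation_mx sys).

Definition closed_loop (K : realType) (n m : nat) (sys : descriptor K n m)
    (F : 'M[K]_(m, n)) : descriptor K n m :=
  let E := matE sys in let J := matJ sys in let R := matR sys in
  let G := matG sys in let P := matP sys in
  let S := matS sys in let N := matN sys in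
  Descriptor E
    (J + 2^-1 *: ((G - P) *m F - F^T *m (G - P)^T))
    (R - 2^-1 *: ((G - P) *m F + F^T *m (G - P)^T))
    (G + 2^-1 *: (F^T *m (S + N)^T))
    (P + 2^-1 *: (F^T *m (S + N)^T))
    S N.

Lemma halfD (K : realType) (p q : nat) (A : 'M[K]_(p, q)) :
  2^-1 *: A + 2^-1 *: A = A.
Proof. by rewrite -scalerDl -[2^-1]mul1r -splitr scale1r. Qed.

Lemma closed_loop_feedback (K : realType) (n m : nat) (sys : descriptor K n m)
    (F : 'M[K]_(m, n)) (dx x : 'cV[K]_n) (v y : 'cV[K]_m) :
  system_eqs sys dx x (F *m x + v) y <->
  system_eqs (closed_loop sys F) dx x v y.
Proof.
case: sys => E J R G P S N; rewrite /system_eqs /closed_loop /=.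
have -> : J + 2^-1 *: ((G - P) *m F - F^T *m (G - P)^T)
    - (R - 2^-1 *: ((G - P) *m F + F^T *m (G - P)^T))
    = J - R + (G - P) *m F.
  apply/matrixP => i j; rewrite !mxE.
  set a := \sum_k _; set b := \sum_k _; by field.
have -> : G + 2^-1 *: (F^T *m (S + N)^T) - (P + 2^-1 *: (F^T *m (S + N)^T))
    = G - P by rewrite opprD addrACA subrr addr0.
have -> : (G + 2^-1 *: (F^T *m (S + N)^T)
    + (P + 2^-1 *: (F^T *m (S + N)^T)))^T = (G + P)^T + (S + N) *m F.
  by rewrite addrACA halfD linearD /= trmx_mul !trmxK.
by rewrite !mulmxDr !mulmxDl !mulmxA !addrA.
Qed.

(* Main.v *)
Require Import Defs.
From mathcomp Require Import all_boot all_order all_algebra.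
From mathcomp Require Import reals ring lra.

(** Put D = S + N, z = D^-1 (G + P)^T x and w = D^-T (G - P)^T x, and let M be
    the matrix in the criterion. Since N is skew, v^T S v = v^T D v, and the
    closed-loop dissipation form is
      x^T M x + (v - w)^T D (F x + v + z).
    At v = w this is x^T M x, whence necessity. For sufficiency, choose F with
    F x = - (w + z): the form becomes x^T M x + (v - w)^T S (v - w). *)

Set Implicit Arguments.
Unset Strict Implicit.
Unset Printing Implicit Defensive.

Import Order.TTheory GRing.Theory Num.Theory.
Local Open Scope ring_scope.

Section Dot.
Variable K : realType.

Definition dot (p : nat) (a b : 'cV[K]_p) : K := (a^T *m b) 0 0.

Lemma dotC p (a b : 'cV[K]_p) : dot a b = dot b a.
Proof. by rewrite /dot !mxE; apply: eq_bigr => i _; rewrite !mxE mulrC. Qed.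

Lemma dotDr p (a b c : 'cV[K]_p) : dot a (b + c) = dot a b + dot a c.
Proof. by rewrite /dot mulmxDr mxE. Qed.

Lemma dotNr p (a b : 'cV[K]_p) : dot a (- b) = - dot a b.
Proof. by rewrite /dot mulmxN mxE. Qed.

Lemma dotZr p k (a b : 'cV[K]_p) : dot a (k *: b) = k * dot a b.
Proof. by rewrite /dot -scalemxAr mxE. Qed.

Lemma dotDl p (a b c : 'cV[K]_p) : dot (a + b) c = dot a c + dot b c.
Proof. by rewrite !(dotC _ c) dotDr. Qed.

Lemma dotNl p (a b : 'cV[K]_p) : dot (- a) b = - dot a b.
Proof. by rewrite !(dotC _ b) dotNr. Qed.

Lemma dot0l p (a : 'cV[K]_p) : dot 0 a = 0.
Proof. by rewrite /dot trmx0 mul0mx mxE. Qed.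

Lemma dot_mulmx p q (A : 'M[K]_(p, q)) a b : dot a (A *m b) = dot (A^T *m a) b.
Proof. by rewrite /dot trmx_mul trmxK mulmxA. Qed.

Lemma dot_col_mx p q (a c : 'cV[K]_p) (b d : 'cV[K]_q) :
  dot (col_mx a b) (col_mx c d) = dot a c + dot b d.
Proof. by rewrite /dot tr_col_mx mul_row_col mxE. Qed.

Lemma formE p (A : 'M[K]_p) x : (x^T *m A *m x) 0 0 = dot x (A *m x).
Proof. by rewrite /dot mulmxA. Qed.

Lemma form_tr p (A : 'M[K]_p) x : dot x (A^T *m x) = dot x (A *m x).
Proof. by rewrite dot_mulmx trmxK dotC. Qed.

Lemma pdmx_ge0 p (A : 'M[K]_p) x : pdmx A -> 0 <= dot x (A *m x).
Proof.
case=> _ A0; have [->|/A0] := eqVneq x 0; first by rewrite dot0l.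
by rewrite formE => /ltW.
Qed.

(** A matrix and its transpose have the same quadratic form, so here the form equals its own
    negative. *)
Lemma form_skew p (N : 'M[K]_p) x : N = - N^T -> dot x (N *m x) = 0.
Proof.
move=> NN; have := form_tr N x; rewrite {2}NN mulNmx dotNr => h.
by rewrite -form_tr; lra.
Qed.

Lemma form_addr_skew p (S N : 'M[K]_p) x :
  N = - N^T -> dot x ((S + N) *m x) = dot x (S *m x).
Proof. by move=> NN; rewrite mulmxDl dotDr (form_skew x NN) addr0. Qed.

(** A nonzero row vector [v] with [v *m (S + N) = 0] would make the form of [S + N] vanish at [v^T],
    but this form is that of [S], which is positive. *)
Lemma unitmx_pdD p (S N : 'M[K]_p) :
  pdmx S -> N = - N^T -> S + N \in unitmx.
Proof.
move=> [_ S0] NN; rewrite unitmxE unitfE; apply/negP => /det0P[v v0 vD].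
have := S0 v^T; rewrite trmx_eq0 => /(_ v0).
by rewrite formE -(form_addr_skew S _ NN) /dot mulmxA trmxK vD mul0mx mxE ltxx.
Qed.

End Dot.

Section ClosedLoop.
Variables (K : realType) (n m : nat).
Variables (E J R : 'M[K]_n) (G P : 'M[K]_(n, m)) (S N : 'M[K]_m).
Hypothesis NN : N = - N^T.
Hypothesis RR : R = R^T.
Hypothesis SS : S = S^T.

Local Notation sys := (Descriptor E J R G P S N).
Local Notation D := (S + N).
Local Notation M := (R + 2^-1 *: ((G - P) *m invmx D *m (G + P)^T)
           + 2^-1 *: ((G + P) *m (invmx D)^T *m (G - P)^T)).

Lemma criterion_mx_sym : M = M^T.
Proof.
set B := G - P; set C := G + P.
have -> : C *m (invmx D)^T *m B^T = (B *m invmx D *m C^T)^T.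
  by rewrite !trmx_mul !trmxK mulmxA.
move: (B *m _ *m _) => A.
by rewrite !linearD /= !linearZ /= trmxK -RR addrAC.
Qed.

Lemma closed_loop_sym F :
  dissipation_mx (closed_loop sys F) = (dissipation_mx (closed_loop sys F))^T.
Proof.
rewrite /dissipation_mx /= tr_block_mx trmxK -SS.
congr (block_mx _ _ _ _).
set B := G - P.
rewrite [RHS]linearB /= -RR [in RHS]linearZ /= [in RHS]linearD /=.
by rewrite !trmx_mul !trmxK; congr (_ - _ *: _); rewrite addrC.
Qed.

(** The two half terms of [M] are transposes of each other, so their forms agree and add up to one
    full term. *)
Lemma criterion_formE x :
  dot x (M *m x) =
  dot x (R *m x) + dot x ((G - P) *m (invmx D *m ((G + P)^T *m x))).
Proof.
move: (G - P) (G + P) => B C.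
have -> : C *m (invmx D)^T *m B^T = (B *m invmx D *m C^T)^T.
  by rewrite !trmx_mul !trmxK mulmxA.
rewrite !mulmxDl -!scalemxAl !dotDr !dotZr form_tr -!mulmxA.
by field.
Qed.

(** This expansion does not involve the inverse of [D], so it is available before [S] is known to be
    positive definite. *)
Lemma dissipation_formE F x v :
  dot (col_mx x v) (dissipation_mx (closed_loop sys F) *m col_mx x v) =
  dot x (R *m x) - dot x ((G - P) *m (F *m x)) + 2 * dot x (P *m v)
  + dot v (D *m (F *m x)) + dot v (S *m v).
Proof.
rewrite /dissipation_mx /= mul_block_col dot_col_mx !dotDr.
move: (G - P) (S + N) => B C.
(* The two off-diagonal blocks [Q] and [Q^T] contribute the same scalar. *)
set Q := P + _; rewrite (dot_mulmx Q^T) trmxK (dotC (Q *m v)) /Q.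
rewrite -(trmx_mul B) mulmxBl -scalemxAl !mulmxDl -scalemxAl.
rewrite !(dotDr, dotNr, dotZr) form_tr -trmx_mul (dot_mulmx (C *m F)^T).
rewrite trmxK (dotC _ v) -!mulmxA.
by field.
Qed.

Hypothesis D_unit : D \in unitmx.

(** Since [D z = (G + P)^T x] and [D^T w = (G - P)^T x], every term except the form of [R] becomes a
    pairing through [D]; these terms factor once [dot w (D *m z)] is moved into the form of [M]. *)
Lemma dissipation_criterionE F x v :
  let z := invmx D *m ((G + P)^T *m x) in
  let w := (invmx D)^T *m ((G - P)^T *m x) in
  dot (col_mx x v) (dissipation_mx (closed_loop sys F) *m col_mx x v) =
  dot x (M *m x) + dot (v - w) (D *m (F *m x + v + z)).
Proof.
move=> z w; rewrite dissipation_formE criterion_formE -/z.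
have Cx : (G + P)^T *m x = D *m z by rewrite /z mulKVmx.
have Bx : (G - P)^T *m x = D^T *m w.
  by rewrite /w mulmxA -trmx_mul mulVmx // trmx1 mul1mx.
have Bdot a : dot x ((G - P) *m a) = dot w (D *m a).
  by rewrite dot_mulmx Bx (dot_mulmx D).
(* Write [2 P = (G + P) - (G - P)]. *)
have Pdot : 2 * dot x (P *m v) = dot v (D *m z) - dot w (D *m v).
  rewrite -Cx -Bdot (dotC v) -dot_mulmx mulmxBl mulmxDl !dotDr dotNr.
  by ring.
rewrite !Bdot Pdot -(form_addr_skew S v NN).
rewrite !mulmxDr !(dotDl, dotNl, dotDr); ring.
Qed.

End ClosedLoop.

Theorem theorem6 (K : realType) (n m : nat)
    (E J R : 'M[K]_n) (G P : 'M[K]_(n, m)) (S N : 'M[K]_m) :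
  port_hamiltonian (Descriptor E J R G P S N) ->
  (exists F : 'M[K]_(m, n),
     strictly_passive (closed_loop (Descriptor E J R G P S N) F)) <->
  (pdmx S /\
   pdmx (R + 2^-1 *: ((G - P) *m invmx (S + N) *m (G + P)^T)
           + 2^-1 *: ((G + P) *m (invmx (S + N))^T *m (G - P)^T))).
Proof.
case=> /= SS NN _ _ [+ _].
rewrite {1}/dissipation_mx /= tr_block_mx => /eq_block_mx[RR _ _ _].
split=> [[F [_ F0]]|[S0 M0]].
(* At [x = 0] only the form of [S] survives. This comes first because it makes [S + N]
   invertible. *)
- have S0 : pdmx S.
    split=> // v v0; have := F0 (col_mx 0 v).
    rewrite col_mx_eq0 (negbTE v0) andbF => /(_ isT).
    rewrite !formE dissipation_formE mulmx0 !dot0l.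
    by rewrite mulmx0 mulr0 subrr !add0r /dot !mulmx0 mxE add0r.
  split=> //; split; first exact: criterion_mx_sym.
  move=> x x0.
  set w := (invmx (S + N))^T *m ((G - P)^T *m x).
  have := F0 (col_mx x w); rewrite col_mx_eq0 (negbTE x0) => /(_ isT).
  rewrite !formE dissipation_criterionE ?unitmx_pdD //.
  by rewrite subrr dot0l addr0.
- exists (- ((invmx (S + N))^T *m (G - P)^T + invmx (S + N) *m (G + P)^T)).
  split; first exact: closed_loop_sym.
  move=> xv; rewrite -[xv]vsubmxK; set x := usubmx xv; set v := dsubmx xv.
  rewrite col_mx_eq0 negb_and formE => xv0.
  rewrite dissipation_criterionE ?unitmx_pdD //.
  set w := _ *m (_ *m x); set z := _ *m (_ *m x).
  (* The chosen feedback makes both factors of the product term equal to [v - w]. *)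
  have -> : - ((invmx (S + N))^T *m (G - P)^T + invmx (S + N) *m (G + P)^T)
      *m x + v + z = v - w.
    by rewrite mulNmx mulmxDl -!mulmxA -/w -/z opprD addrAC subrK addrC.
  rewrite (form_addr_skew S _ NN).
  (* If [x = 0], then [w = 0] and [v] is nonzero, so strictness comes from [S]; otherwise it comes
     from the criterion matrix, and the [S] term is nonnegative. *)
  have [x0|x0] := eqVneq x 0.
    move: xv0; rewrite x0 eqxx /= => v0.
    have -> : w = 0 by rewrite /w x0 !mulmx0.
    by rewrite dot0l add0r subr0 -formE; apply: (proj2 S0).
  by rewrite ltr_pwDl ?pdmx_ge0 // -formE; apply: (proj2 M0).
Qed.
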